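(* Let $N\ge 1$ be an integer, $T>0$, $\alpha\in(0,1)$, $\sigma>0$, $\nu,\mu\in\mathbb{R}$ with $\mu>\nu$, and $\rho_1,\dots,\rho_N\in\mathbb{R}$. Assume that either $$\gamma\in(0,1)\quad\text{and}\quad \max_{i=1,\dots,N}\rho_i\le\alpha\Big(\nu+\frac{(\mu-\nu)^2}{2\gamma\sigma^2}\Big),$$ or $$\gamma\in[1-\alpha,1).$$ Then the system of ordinary differential equations on $[0,T]$ $$ \begin{cases} \dot{\theta}_i(t)+(1-\gamma)\theta_i(t)\Big[\nu+\frac{(\mu-\nu)^2}{2\gamma\sigma^2}-\Big(\sum_{j=1}^N\theta_j(t)\Big)^{\frac{1}{\alpha-1}}\sum_{k=1}^N\theta_k(t)^{\frac{1-\gamma-\alpha}{(1-\alpha)(1-\gamma)}}\Big]\\ \quad-(1-\gamma)\rho_i\alpha^{-1}\theta_i(t)+\alpha^{-1}(1-\gamma)\theta_i(t)^{\frac{1-\gamma-\alpha}{(1-\alpha)(1-\gamma)}}\Big(\sum_{j=1}^N\theta_j(t)\Big)^{\frac{\alpha}{\alpha-1}}=0,\\ \theta_i(T)=1,\qquad i=1,\dots,N, \end{cases} $$ admits a unique positive solution $(\theta_1,\dots,\theta_N)$.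
   Context: A positive solution is a solution $(\theta_1,\dots,\theta_N)$ on the whole interval $[0,T]$ with $\theta_i(t)>0$ for all $t\in[0,T]$ and all $i=1,\dots,N$. *)

(* Defs.v *)
From HB Require Import structures.
From mathcomp Require Import all_boot all_order all_algebra.
From mathcomp Require Import all_classical all_reals all_analysis.
Set Implicit Arguments.
Unset Strict Implicit.
Unset Printing Implicit Defensive.
Import Order.TTheory GRing.Theory Num.Theory.
Import numFieldNormedType.Exports.
Local Open Scope classical_set_scope.
Local Open Scope ring_scope.

(* Derivative relative to a set [A]: one-sided at the endpoints when [A] is a
   closed interval, and two-sided at interior points. The values of [f] outside
   [A] are irrelevant (for [t] in [A]). *)
Definition is_derive_within (R : realType) (A : set R) (f : R -> R) (t d : R)
    : Prop :=
  (f s - f t) / (s - t) @[s --> within A t^'] --> d.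

(* Powers are [powR]; its conventions at nonpositive bases play no role for
   positive solutions, where every base is positive. *)
Definition ode_solution (R : realType) (N : nat)
    (T alpha sigma nu mu gamma : R) (rho : 'I_N -> R)
    (theta : 'I_N -> R -> R) : Prop :=
  (forall (i : 'I_N) (t : R), t \in `[0, T] ->
     exists2 d : R, is_derive_within `[0, T] (theta i) t d &
       d
       + (1 - gamma) * theta i t *
           (nu + (mu - nu) ^+ 2 / (2 * gamma * sigma ^+ 2)
            - (\sum_(j < N) theta j t) `^ (1 / (alpha - 1)) *
              \sum_(k < N) theta k t `^
                ((1 - gamma - alpha) / ((1 - alpha) * (1 - gamma))))
       - (1 - gamma) * rho i * alpha^-1 * theta i t
       + alpha^-1 * (1 - gamma) *
           theta i t `^ ((1 - gamma - alpha) / ((1 - alpha) * (1 - gamma))) *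
           (\sum_(j < N) theta j t) `^ (alpha / (alpha - 1))
       = 0) /\
  (forall i : 'I_N, theta i T = 1).

Definition positive_solution (R : realType) (N : nat)
    (T alpha sigma nu mu gamma : R) (rho : 'I_N -> R)
    (theta : 'I_N -> R -> R) : Prop :=
  ode_solution T alpha sigma nu mu gamma rho theta /\
  (forall (i : 'I_N) (t : R), t \in `[0, T] -> 0 < theta i t).

(* Main.v *)
Require Import Defs.
From HB Require Import structures.
From mathcomp Require Import all_boot all_order all_algebra.
From mathcomp Require Import all_classical all_reals all_analysis.
From mathcomp Require Import ring lra.
Set Implicit Arguments.
Unset Strict Implicit.
Unset Printing Implicit Defensive.
Import Order.TTheory GRing.Theory Num.Theory.
Import numFieldNormedType.Exports.
Local Open Scope classical_set_scope.
Local Open Scope ring_scope.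

(** In logarithmic coordinates [x i = ln (theta i)], with
    [b = alpha gamma / ((1 - alpha) (1 - gamma)) > 0],
    [e = alpha / (1 - alpha) > 0], [s = ln (sum_k exp (x k))] and weights
    [w k = exp (x k - s)] of total mass 1, the system reads
    [x i' = - (1 - gamma) rate i] where
      [rate i = c i - exp (- e s) (sum_k w k exp (- b x k)
                                   - exp (- b x i) / alpha)]
    and [c i] is a constant (lemma [ode_terms_rate]).

    Two features of [rate] give the theorem.
    - If [x i] is the least coordinate, then [exp (- b x i)] is the largest of
      the numbers [exp (- b x k)], so it is at least their [w]-average; as
      [alpha <= 1] this gives [rate i >= c i] (lemma [rate_argmin]).  Running
      backwards from [x = 0] at time [T], the smallest coordinate thus falls
      at most linearly and stays above an explicit level [L] on [[0, T]]
      (lemma [min_principle]).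
    - On [{x | all coordinates >= L}] every exponential in [rate] has its
      exponent bounded above by [- (b + e) L], since [x k <= s]; hence [rate]
      is Lipschitz there (lemma [rate_lipschitz]).  Only a lower bound is
      required, so blow-up from above needs no separate argument.

    For existence, the coordinates are cut off at [L] from below; the modified
    field is globally Lipschitz and has a solution on [[0, T]]
    ([cauchy_lipschitz]).  The cut-off does not spoil the first feature, so
    this solution never goes below [L] and solves the original system.  For
    uniqueness, the logarithms of two positive solutions are continuous on a
    compact interval, hence bounded below by a common level, above which the
    field is Lipschitz ([lipschitz_unique]).

    Both Picard iteration and uniqueness rest on one estimate,
    [weighted_contraction]: for the weight [exp (2 K (T - t))] a field of
    Lipschitz constant [K] halves distances when integrated back from [T]. *)

(** * Primitives on a compact interval *)

(** Continuity up to the ends and a derivative inside is all that the mean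
    value theorem needs; one-sided derivatives at the ends enter only through
    continuity. *)
Definition primitive_on (R : realType) (a b : R) (F f : R -> R) : Prop :=
  {within `[a, b], continuous F} /\
  (forall t, t \in `]a, b[ -> is_derive t 1 F (f t)).

Lemma derive_primitive_on (R : realType) (a b : R) (F f : R -> R) :
  (forall t, t \in `[a, b] -> is_derive t 1 F (f t)) -> primitive_on a b F f.
Proof.
move=> dF; split; last by move=> t /subset_itv_oo_cc; exact: dF.
apply: continuous_in_subspaceT => t; rewrite inE => /dF dFt.
apply: differentiable_continuous; apply/derivable1_diffP.
exact: (@ex_derive _ _ _ _ _ _ _ dFt).
Qed.

Lemma primitive_onB (R : realType) (a b : R) (F f G g : R -> R) :
  primitive_on a b F f -> primitive_on a b G g ->
  primitive_on a b (F \- G) (f \- g).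
Proof.
move=> [cF dF] [cG dG]; split.
  by move=> t; apply: continuousB; [exact: cF|exact: cG].
by move=> t tab; have ? := dF _ tab; have ? := dG _ tab; exact: is_deriveB.
Qed.

(** The problem is posed backwards in time, so the comparison starts from
    [b] and the inequality between derivatives is reversed. *)
Lemma le_primitive_on (R : realType) (a b : R) (F f G g : R -> R) :
  primitive_on a b F f -> primitive_on a b G g ->
  (forall t, t \in `]a, b[ -> g t <= f t) -> F b <= G b ->
  forall t, t \in `[a, b] -> F t <= G t.
Proof.
move=> pF pG gf FGb t tab; have [cH dH] := primitive_onB pF pG.
have /andP[at_ tb] : a <= t <= b by rewrite in_itv in tab.
rewrite -subr_le0; apply: le_trans (_ : F b - G b <= 0); last by rewrite subr_le0.
apply: (@ger0_derive1_le_cc R (F \- G) a b _ _ cH t b) => //.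
- by move=> x /dH dHx; exact: (@ex_derive _ _ _ _ _ _ _ dHx).
- move=> x xab; rewrite derive1E; have dHx := dH _ xab; rewrite derive_val.
  by rewrite /= subr_ge0 gf.
- by rewrite in_itv /= lexx (le_trans at_ tb).
Qed.

Lemma norm_le_primitive_on (R : realType) (a b : R) (F f G g : R -> R) :
  primitive_on a b F f -> primitive_on a b G g ->
  (forall t, t \in `]a, b[ -> `|f t| <= - g t) -> `|F b| <= G b ->
  forall t, t \in `[a, b] -> `|F t| <= G t.
Proof.
move=> pF pG fg FGb t tab.
have pN : primitive_on a b (\- F) (\- f).
  case: pF => cF dF; split.
    by move=> x; apply: continuousN; exact: cF.
  by move=> x xab; have ? := dF _ xab; exact: is_deriveN.
move: FGb; rewrite !ler_norml !(lerNl (G _)) => /andP[FGb1 FGb2]; apply/andP; split.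
  apply: (le_primitive_on pN pG) => // x /fg; rewrite ler_norml => /andP[h1 h2] /=.
  lra.
apply: (le_primitive_on pF pG) => // x /fg; rewrite ler_norml => /andP[h1 h2] /=.
lra.
Qed.

(** The weight [W t = exp (2 K (T - t))] satisfies [K W = - W' / 2], so
    integrating a bound [K A W] back from [T] returns [A W / 2].  This makes
    one Picard step a contraction on the whole of [[0, T]], however long. *)
Lemma weighted_contraction (R : realType) (K A T : R) (F f : R -> R) :
  0 <= A ->
  primitive_on 0 T F f -> F T = 0 ->
  (forall t, t \in `[0, T] -> `|f t| <= K * (A * expR (2 * K * (T - t)))) ->
  forall t, t \in `[0, T] -> `|F t| <= A / 2 * expR (2 * K * (T - t)).
Proof.
move=> A0 pF FT fle.
pose G t := A / 2 * expR (2 * K * (T - t)).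
apply: (norm_le_primitive_on pF (G := G)
          (g := fun t => - (K * (A * expR (2 * K * (T - t)))))).
- apply: derive_primitive_on => t _; rewrite /G.
  have d1 : is_derive t 1 (fun t : R => 2 * K * (T - t)) (- (2 * K)).
    by apply: is_derive_eq; rewrite /GRing.scale /=; ring.
  have d2 := is_derive1_comp (is_derive_expR _) d1.
  apply: (is_derive_eq (is_deriveZ (A / 2) d2)); rewrite /GRing.scale /=; by field.
- by move=> t tT; rewrite opprK fle// subset_itv_oo_cc.
- by rewrite FT normr0 /G mulr_ge0 ?expR_ge0// divr_ge0.
Qed.

(** The integral starts at [a - 1] so that the primitive has a two-sided
    derivative at [a] as well. *)
Lemma continuous_has_primitive (R : realType) (a b : R) (f : R -> R) :
  continuous f ->
  exists F : R -> R, F b = 0 /\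
    forall t, t \in `[a, b] -> is_derive t 1 F (f t).
Proof.
move=> cf.
pose I x : R := (\int[lebesgue_measure]_(t in `[a - 1, x]) f t)%R.
exists (fun x => I x - I b); split; first by rewrite subrr.
move=> t tab; have /andP[at_ tb] : a <= t <= b by rewrite in_itv in tab.
have lt1 : t < b + 1 by lra.
have lt2 : a - 1 < t by lra.
have fi : lebesgue_measure.-integrable `[a - 1, b + 1] (EFin \o f).
  apply: continuous_compact_integrable; first exact: segment_compact.
  exact: continuous_subspaceT.
have [dI I'] := continuous_FTC1_closed lt1 fi lt2 (cf t).
have dIt : is_derive t 1 I (f t).
  by apply: DeriveDef; [exact: dI|rewrite -I' derive1E].
rewrite -[f t]subr0; exact: is_deriveB.
Qed.

(** * Derivatives relative to an interval *)

Lemma is_derive1_distP (R : realType) (f : R -> R) (t d : R) :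
  is_derive t 1 f d <->
  (forall e, 0 < e -> exists2 r, 0 < r & forall s, s != t -> `|s - t| < r ->
     `|d - (f s - f t) / (s - t)| <= e).
Proof.
have cvgE : (h^-1 *: (f (h *: 1 + t) - f t) @[h --> 0^'] --> d) <->
  (forall e, 0 < e -> exists2 r, 0 < r & forall s, s != t -> `|s - t| < r ->
     `|d - (f s - f t) / (s - t)| <= e).
  split=> [/cvgrPdist_le fd e e0|fd].
    have /nbhs_ballP[r /= r0 rP] := fd _ e0; exists r => // s st sr.
    have := rP (s - t); rewrite /ball /= sub0r normrN subr_eq0 => /(_ sr st).
    by rewrite /GRing.scale /= mulr1 subrK mulrC.
  apply/cvgrPdist_le => e e0; have [r r0 rP] := fd _ e0.
  apply/nbhs_ballP; exists r => //= h; rewrite /ball /= sub0r normrN => hr h0.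
  have := rP (h + t); rewrite addrK => /(_ _ hr).
  rewrite -subr_eq0 addrK => /(_ h0).
  by rewrite /GRing.scale /= mulr1 mulrC.
split=> [[df dfE]|/cvgE fd].
  by apply/cvgE; rewrite -dfE; exact: df.
apply: DeriveDef; first by apply/cvg_ex; exists d.
exact: cvg_lim.
Qed.

Lemma is_derive_within_distP (R : realType) (A : set R) (f : R -> R) (t d : R) :
  is_derive_within A f t d <->
  (forall e, 0 < e -> exists2 r, 0 < r &
     forall s, A s -> s != t -> `|s - t| < r ->
       `|d - (f s - f t) / (s - t)| <= e).
Proof.
split=> [/cvgrPdist_le fd e e0|fd].
  have /nbhs_ballP[r /= r0 rP] := fd _ e0; exists r => // s As st sr.
  by apply: rP => //; rewrite /ball /= distrC.
apply/cvgrPdist_le => e e0; have [r r0 rP] := fd _ e0.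
apply/nbhs_ballP; exists r => //= s; rewrite /ball /= distrC => sr st As.
exact: rP.
Qed.

Lemma is_derive_is_derive_within (R : realType) (A : set R) (f : R -> R)
    (t d : R) :
  is_derive t 1 f d -> is_derive_within A f t d.
Proof.
move=> /is_derive1_distP fd; apply/is_derive_within_distP => e /fd[r r0 rP].
by exists r => // s _; exact: rP.
Qed.

(** Near [t] the difference quotients are bounded by [|f t| + 1], which gives
    continuity up to the ends; inside the interval the restriction to
    [[a, b]] is void for [s] close to [t]. *)
Lemma is_derive_within_primitive_on (R : realType) (a b : R) (F f : R -> R) :
  (forall t, t \in `[a, b] -> is_derive_within `[a, b] F t (f t)) ->
  primitive_on a b F f.
Proof.
move=> dF; split.
  apply/subspace_continuousP => t tab; apply/cvgrPdist_le => e e0.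
  have /is_derive_within_distP/(_ 1 ltr01)[r r0 rP] := dF t tab.
  pose M := `|f t| + 1.
  have M0 : 0 < M by rewrite /M ltr_wpDl.
  apply/nbhs_ballP; exists (Num.min r (e / M)).
    by rewrite /= lt_min r0 divr_gt0.
  move=> s; rewrite /ball /= lt_min distrC => /andP[sr seM] sab.
  have [->|st] := eqVneq s t; first by rewrite subrr normr0 ltW.
  have q : `|(F s - F t) / (s - t)| <= M.
    have := rP s sab st sr; have := ler_normB (f t) (f t - (F s - F t) / (s - t)).
    by rewrite opprB addrC subrK /M; lra.
  rewrite distrC; have := ler_pM (normr_ge0 _) (normr_ge0 _) q (ltW seM).
  by rewrite -normrM divfK ?subr_eq0// mulrCA divff ?mulr1// gt_eqF.
move=> t tab; have tab' : t \in `[a, b] := subset_itv_oo_cc tab.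
apply/is_derive1_distP => e e0.
have /is_derive_within_distP/(_ _ e0)[r r0 rP] := dF t tab'.
have /andP[at_ tb] : a < t < b by rewrite in_itv in tab.
exists (Num.min r (Num.min (t - a) (b - t))); first by rewrite !lt_min r0 !subr_gt0 at_.
move=> s st; rewrite !lt_min => /and3P[sr sa sb]; apply: rP => //=.
by rewrite in_itv /=; move: sa sb; rewrite !ltr_norml => /andP[? ?] /andP[? ?];
  apply/andP; split; lra.
Qed.

Lemma ln_primitive_on (R : realType) (a b : R) (F f : R -> R) :
  (forall t, t \in `[a, b] -> 0 < F t) -> primitive_on a b F f ->
  primitive_on a b (fun t => ln (F t)) (fun t => (F t)^-1 * f t).
Proof.
move=> F0 [cF dF]; split.
  apply/subspace_continuousP => t tab.
  have /subspace_continuousP/(_ t tab) cFt := cF.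
  by apply: continuous_cvg cFt; apply: continuous_ln; exact: F0.
move=> t tab; have dFt := dF t tab.
apply: (@is_derive1_comp _ (@ln R) F); apply: is_derive1_ln.
by apply: F0; exact: subset_itv_oo_cc tab.
Qed.

(** * Geometrically convergent sequences *)

Lemma half_pow_le (R : archiRealFieldType) (C e : R) : 0 < e ->
  exists n, C / 2 ^+ n <= e.
Proof.
move=> e0; exists (Num.bound (`|C| / e)).
rewrite ler_pdivrMr ?exprn_gt0// mulrC -ler_pdivrMr//.
apply: (@le_trans _ _ (`|C| / e)); first by rewrite ler_pM2r ?invr_gt0// ler_norm.
apply/ltW/(lt_le_trans (archi_boundP _)); first by rewrite divr_ge0// ltW.
by rewrite -natrX ler_nat ltnW// ltn_expl.
Qed.

Lemma eq0_half_pow_le (R : archiRealFieldType) (C x : R) :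
  (forall n, `|x| <= C / 2 ^+ n) -> x = 0.
Proof.
move=> xC; apply/normr0_eq0/eqP; rewrite eq_le normr_ge0 andbT.
apply/ler_addgt0Pl => e e0; rewrite addr0.
have [n Ce] := half_pow_le C e0; exact: le_trans (xC n) Ce.
Qed.

(** The sequences [u n - r n] and [u n + r n], with [r n = 2 A / 2 ^ n], are
    nondecreasing and nonincreasing, so the intervals they bound are nested;
    the limit is a common point of these intervals. *)
Lemma half_pow_cauchy (R : realType) (A : R) (u : nat -> R) :
  (forall n, `|u n.+1 - u n| <= A / 2 ^+ n) ->
  exists l, forall n, `|l - u n| <= 2 * A / 2 ^+ n.
Proof.
move=> uA; pose r n := 2 * A / 2 ^+ n.
have rS n : r n - r n.+1 = A / 2 ^+ n.
  rewrite /r exprS; field; by rewrite expf_neq0.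
have lo : {homo (fun n => u n - r n) : m n / (m <= n)%N >-> m <= n}.
  apply: homo_leq => [//|x y z|n]; first exact: le_trans.
  by have := uA n; rewrite -rS ler_norml => /andP[]; lra.
have hi : {homo (fun n => u n + r n) : m n / (m <= n)%N >-> n <= m}.
  apply: homo_leq => [//|x y z xy yz|n]; first exact: le_trans yz xy.
  by have := uA n; rewrite -rS ler_norml => /andP[]; lra.
have r0 n : 0 <= r n.
  have A0 : 0 <= A by have := le_trans (normr_ge0 _) (uA 0%N); rewrite divr1.
  by rewrite divr_ge0 ?mulr_ge0// exprn_ge0.
have lohi m n : u m - r m <= u n + r n.
  have h1 := lo _ _ (leq_maxl m n); have h2 := hi _ _ (leq_maxr m n).
  have := r0 (maxn m n); move: h1 h2 => /=; lra.
pose S := range (fun n => u n - r n).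
have ubS n : ubound S (u n + r n) by move=> _ [m _ <-].
have S0 : S !=set0 by exists (u 0%N - r 0%N), 0%N.
have supS : has_sup S by split => //; exists (u 0%N + r 0%N).
exists (sup S) => n; rewrite -/(r n) ler_distl; apply/andP; split.
  by apply: (sup_upper_bound supS); exists n.
exact: ge_sup.
Qed.

(** * The terminal value problem for a Lipschitz field *)

(** Global existence by Picard iteration.  The hypothesis on [G] is the
    Lipschitz condition for the sup distance.  Iterates are read only through
    the retraction [clip] of the line onto [[0, T]]: this gives continuous
    functions on the line, whose primitives are differentiable on both sides
    at [0] and [T]. *)
Lemma cauchy_lipschitz (R : realType) (I : finType) (T K : R)
    (G : (I -> R) -> I -> R) (y0 : I -> R) :
  0 <= T -> 0 < K ->
  (forall x y d, (forall j, `|x j - y j| <= d) ->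
     forall i, `|G x i - G y i| <= K * d) ->
  exists Y : I -> R -> R, forall i, Y i T = y0 i /\
    forall t, t \in `[0, T] -> is_derive t 1 (Y i) (G (Y ^~ t) i).
Proof.
move=> T0 K0 lipG.
pose clip (s : R) := Num.max 0 (Num.min T s).
have clipT s : clip s \in `[0, T].
  by rewrite in_itv /= le_max lexx /= ge_max T0 ge_min lexx.
have clipE s : s \in `[0, T] -> clip s = s.
  by rewrite in_itv /= => /andP[s0 sT]; rewrite /clip min_r// max_r.
have cclip : continuous clip.
  move=> s; apply: (@continuous_max _ _ (cst 0) (fun s => Num.min T s)).
    exact: cvg_cst.
  by apply: (@continuous_min _ _ (cst T) id); [exact: cvg_cst|exact: cvg_id].
pose cont (y : I -> R -> R) := forall j, continuous (fun s => y j (clip s)).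
pose sol (y z : I -> R -> R) := forall i, z i T = y0 i /\
    forall t, t \in `[0, T] -> is_derive t 1 (z i) (G (y ^~ t) i).
have solP y : cont y -> exists z, sol y z.
  move=> cy.
  have cG i : continuous (fun s => G (fun j => y j (clip s)) i).
    move=> s; apply/cvgrPdist_le => e e0.
    have eK : 0 < e / K by rewrite divr_gt0.
    have : \forall s' \near s, forall j, `|y j (clip s) - y j (clip s')| <= e / K.
      apply: (@filter_forall R I
        (fun j s' => `|y j (clip s) - y j (clip s')| <= e / K) (nbhs s) _) => j.
      by have /cvgrPdist_le/(_ _ eK) := cy j s.
    by apply: filterS => s' /lipG/(_ i); rewrite mulrCA divff ?gt_eqF// mulr1.
  have /choice[z zP] i := continuous_has_primitive 0 T (cG i).
  exists (fun i t => z i t + y0 i) => i; have [zT dz] := zP i.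
  split=> [|t tT]; first by rewrite zT add0r.
  have dzt := dz t tT; rewrite clipE// in dzt.
  rewrite -[G _ _]addr0; exact: is_deriveD.
have cont_sol y z : sol y z -> cont z.
  move=> yz j s; apply: continuous_comp; first exact: cclip.
  have [_ /(_ _ (clipT s)) dz] := yz j.
  apply: differentiable_continuous; apply/derivable1_diffP.
  exact: (@ex_derive _ _ _ _ _ _ _ dz).
have /choice[Phi PhiP] : forall y, exists z, cont y -> sol y z.
  move=> y; have [/solP[z yz]|ny] := pselect (cont y); first by exists z.
  by exists y.
pose Y n := iter n Phi (fun i _ => y0 i).
have contY n : cont (Y n).
  elim: n => [j|n IH]; first by move=> s; exact: cvg_cst.
  exact: cont_sol (PhiP _ IH).
have solY n : sol (Y n) (Y n.+1) by exact: PhiP.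
pose W t := expR (2 * K * (T - t)).
have contr (y z y' z' : I -> R -> R) B : 0 <= B -> sol y z -> sol y' z' ->
    (forall t, t \in `[0, T] -> forall j, `|y j t - y' j t| <= B * W t) ->
    forall t, t \in `[0, T] -> forall j, `|z j t - z' j t| <= B / 2 * W t.
  move=> B0 yz yz' yy' t tT j.
  have [zT dz] := yz j; have [z'T dz'] := yz' j.
  apply: (@weighted_contraction _ K B T (z j \- z' j)
            (fun t => G (y ^~ t) j - G (y' ^~ t) j)) => //.
  - exact: primitive_onB (derive_primitive_on dz) (derive_primitive_on dz').
  - by rewrite /= zT z'T subrr.
  - by move=> s sT; apply: lipG => i; exact: yy'.
have [A A0 YA] : exists2 A, 0 <= A & forall n t, t \in `[0, T] -> forall j,
    `|Y n.+1 j t - Y n j t| <= A / 2 ^+ n * W t.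
  (* The first increment has derivative at most [A <= K (A / K) W], so the
     contraction lemma already bounds it by half of [A / K]. *)
  pose A := \sum_i `|G y0 i|.
  have A0 : 0 <= A by exact: sumr_ge0.
  exists (A / K / 2); first by rewrite !divr_ge0// ltW.
  elim=> [|n IH] t tT j.
    have [YT dY] := solY 0%N j.
    rewrite divr1.
    apply: (@weighted_contraction _ K (A / K) T (fun t => Y 1%N j t - y0 j)
              (fun t => G y0 j)) => //.
    - by rewrite divr_ge0// ltW.
    - apply: derive_primitive_on => s sT; have dYs := dY _ sT.
      by rewrite -[G _ _]subr0; exact: is_deriveB.
    - by rewrite YT subrr.
    - move=> s; rewrite in_itv /= => /andP[_ sT].
      rewrite mulrA mulrCA divff ?gt_eqF// mulr1.
      apply: (@le_trans _ _ A).
        by rewrite /A (bigD1 j)//= lerDl sumr_ge0.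
      rewrite ler_peMr// -expR0 ler_expR !mulr_ge0// ?subr_ge0//; exact: ltW.
  rewrite exprS invfM [2^-1 * _]mulrC mulrA.
  apply: contr (solY n.+1) (solY n) _ _ tT j => //.
  by rewrite !divr_ge0// ?exprn_ge0// ltW.
have W0 t : 0 < W t by exact: expR_gt0.
have /choice[Z ZP] : forall j, exists Zj : R -> R, forall t, t \in `[0, T] ->
    forall n, `|Zj t - Y n j t| <= 2 * A / 2 ^+ n * W t.
  move=> j.
  have /choice[Zj ZjP] : forall t, exists l, t \in `[0, T] -> forall n,
      `|l - Y n j t| <= 2 * A / 2 ^+ n * W t.
    move=> t; have [tT|_] := boolP (t \in `[0, T]); last by exists 0.
    have [n|l lP] := @half_pow_cauchy R (A * W t) (fun n => Y n j t).
      by rewrite mulrAC YA.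
    by exists l => _ n; rewrite mulrAC -(mulrA 2) lP.
  by exists Zj.
have contZ : cont Z.
  move=> j s; apply/cvgrPdist_le => e e0.
  have WT t : t \in `[0, T] -> W t <= W 0.
    rewrite in_itv /= => /andP[t0 _]; rewrite ler_expR ler_pM2l ?mulr_gt0//.
    by rewrite lerB.
  have e3 : 0 < e / 3 by rewrite divr_gt0.
  have [n nP] := half_pow_le (2 * A * W 0) e3.
  have close t : t \in `[0, T] -> `|Z j t - Y n j t| <= e / 3.
    move=> tT; apply: le_trans (ZP j _ tT n) _; apply: le_trans nP.
    rewrite mulrAC ler_pM2r ?invr_gt0 ?exprn_gt0// ler_wpM2l ?WT//.
    by rewrite mulr_ge0.
  have /cvgrPdist_le/(_ _ e3) := contY n j s.
  apply: filterS => s' /=; have := close _ (clipT s); have := close _ (clipT s').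
  rewrite !ler_norml => /andP[? ?] /andP[? ?] /andP[? ?]; apply/andP; split; lra.
(* One more Picard step [Z'] from the limit [Z] is still the limit of the
   iterates; hence it equals [Z], and its equation becomes the desired one. *)
have [Z' ZZ'] := solP _ contZ.
suff eqZ t : t \in `[0, T] -> forall j, Z' j t = Z j t.
  exists Z' => i; have [Z'T dZ'] := ZZ' i; split=> // t tT.
  rewrite (_ : Z' ^~ t = Z ^~ t); first exact: dZ'.
  by apply/funext => j; exact: eqZ.
move=> tT j; apply/eqP; rewrite -subr_eq0; apply/eqP.
apply: (@eq0_half_pow_le _ (2 * A * W t)) => n.
have h1 : `|Z' j t - Y n.+1 j t| <= 2 * A / 2 ^+ n / 2 * W t.
  apply: contr ZZ' (solY n) _ _ tT j => [|s sT i]; last exact: ZP.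
  by rewrite divr_ge0 ?mulr_ge0 ?exprn_ge0.
have h2 := ZP j t tT n.+1.
rewrite -(subrKA (Y n.+1 j t)); apply: le_trans (ler_normD _ _) _.
rewrite -[`|Y _ _ _ - _|]normrN opprB.
apply: le_trans (lerD h1 h2) _.
rewrite exprS invfM.
by rewrite le_eqVlt; apply/orP; left; apply/eqP; field; rewrite expf_neq0.
Qed.

Lemma within_continuous_lower_bound (R : realType) (I : finType) (a b : R)
    (X : I -> R -> R) :
  (forall i, {within `[a, b], continuous (X i)}) ->
  exists L, forall i t, t \in `[a, b] -> L <= X i t.
Proof.
move=> cX.
have /choice[m mP] : forall i, exists m, forall t, t \in `[a, b] -> m <= X i t.
  move=> i; have [ab|ba] := leP a b.
    by have [c _ cP] := EVT_min ab (cX i); exists (X i c).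
  by exists 0 => t; rewrite in_itv /= => /andP[at_ /(le_trans at_)]; rewrite leNgt ba.
exists (- \sum_i `|m i|) => i t /(mP i); apply: le_trans.
rewrite lerNl; apply: (@le_trans _ _ `|m i|); first by rewrite -normrN ler_norm.
by rewrite (bigD1 i)//= lerDl sumr_ge0.
Qed.

(** The difference of two solutions is bounded, being continuous on a compact
    interval; applying [weighted_contraction] [n] times gives the bound
    [A / 2 ^ n] in the weighted norm.  The Lipschitz condition is asked only
    on a region [P] that both solutions stay in. *)
Lemma lipschitz_unique (R : realType) (I : finType) (T K : R)
    (P : (I -> R) -> Prop) (G : (I -> R) -> I -> R) (X Y : I -> R -> R) :
  0 < K ->
  (forall x y d, P x -> P y -> (forall j, `|x j - y j| <= d) ->
     forall i, `|G x i - G y i| <= K * d) ->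
  (forall t, t \in `[0, T] -> P (X ^~ t) /\ P (Y ^~ t)) ->
  (forall i, primitive_on 0 T (X i) (fun t => G (X ^~ t) i)) ->
  (forall i, primitive_on 0 T (Y i) (fun t => G (Y ^~ t) i)) ->
  (forall i, X i T = Y i T) ->
  forall i t, t \in `[0, T] -> X i t = Y i t.
Proof.
move=> K0 lipG PXY dX dY XYT i t tT.
have dXY j := primitive_onB (dX j) (dY j).
have dYX j := primitive_onB (dY j) (dX j).
have [L1 L1P] := within_continuous_lower_bound (fun j => proj1 (dXY j)).
have [L2 L2P] := within_continuous_lower_bound (fun j => proj1 (dYX j)).
have T0 : 0 <= T by move: tT; rewrite in_itv /= => /andP[]; exact: le_trans.
have TT : T \in `[0, T] by rewrite in_itv /= T0 lexx.
pose A := Num.max (- L1) (- L2).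
have A0 : 0 <= A.
  by rewrite le_max; have := L1P i T TT; rewrite /= XYT subrr oppr_ge0 => ->.
have step n : forall s, s \in `[0, T] -> forall j,
    `|X j s - Y j s| <= A / 2 ^+ n * expR (2 * K * (T - s)).
  elim: n => [s sT j|n IH s sT j].
    have h1 := L1P j s sT; have h2 := L2P j s sT; rewrite /= in h1 h2.
    apply: (@le_trans _ _ A).
      rewrite ler_norml /A lerNl !le_max.
      by apply/andP; split; apply/orP; [left|right]; lra.
    rewrite divr1 ler_peMr// -expR0 ler_expR !mulr_ge0// ?(ltW K0)// subr_ge0.
    by move: sT; rewrite in_itv /= => /andP[].
  rewrite exprS invfM [2^-1 * _]mulrC mulrA.
  apply: (weighted_contraction _ (dXY j)) sT; first by rewrite divr_ge0 ?exprn_ge0.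
    by rewrite /= XYT subrr.
  move=> r rT; have [PX PY] := PXY r rT.
  by apply: lipG => // k; exact: IH.
apply/eqP; rewrite -subr_eq0; apply/eqP.
apply: (@eq0_half_pow_le _ (A * expR (2 * K * (T - t)))) => n.
by rewrite mulrAC step.
Qed.

(** * A minimum principle *)

(** Let [h k s = Y k s + C (T - s)] be minimal, over all [k] and [s], at
    [(j0, t0)].  Then [Y j0] is the least coordinate at time [t0], so [h j0]
    has a negative derivative there; if [t0 < T], it takes smaller values just
    after [t0].  Hence [t0 = T], where [h] is at least [m].  The derivative at
    the minimizer is used only to the right, which allows [t0 = 0]. *)
Lemma min_principle (R : realType) (I : finType) (T C m : R)
    (Y D : I -> R -> R) :
  (forall i, m <= Y i T) ->
  (forall i t, t \in `[0, T] -> is_derive t 1 (Y i) (D i t)) ->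
  (forall i t, t \in `[0, T] -> (forall k, Y i t <= Y k t) -> D i t < C) ->
  forall i t, t \in `[0, T] -> m - C * (T - t) <= Y i t.
Proof.
move=> YT dY DC i t tT.
have T0 : 0 <= T by move: tT; rewrite in_itv /= => /andP[]; exact: le_trans.
pose h j s := Y j s + C * (T - s).
have dh j s : s \in `[0, T] -> is_derive s 1 (h j) (D j s - C).
  move=> sT; have ? := dY j s sT.
  by apply: is_derive_eq; rewrite /GRing.scale /=; ring.
have /choice[tau tauP] : forall j, exists t0, t0 \in `[0, T] /\
    forall s, s \in `[0, T] -> h j t0 <= h j s.
  move=> j; have [ch _] := derive_primitive_on (dh j).
  by have [t0 t0T t0P] := EVT_min T0 ch; exists t0.
have [j0 _ j0P] := @arg_minP _ _ _ i xpredT (fun j => h j (tau j)) isT.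
have [t0T t0min] := tauP j0; set t0 := tau j0 in t0T t0min j0P.
have hmin k s : s \in `[0, T] -> h j0 t0 <= h k s.
  by move=> sT; apply: le_trans (j0P k isT) _; have [_] := tauP k; apply.
have D0 : D j0 t0 < C.
  by apply: DC => // k; have := hmin k _ t0T; rewrite lerD2r.
have [t0E|t0T'] := eqVneq t0 T.
  have := hmin i t tT; rewrite t0E /h subrr mulr0 addr0.
  by have := YT j0; lra.
have [t00 t0lt] : 0 <= t0 /\ t0 < T.
  by move: t0T; rewrite in_itv /= => /andP[-> ?]; rewrite lt_neqAle t0T'.
have CD0 : 0 < (C - D j0 t0) / 2 by rewrite divr_gt0// subr_gt0.
have /is_derive1_distP/(_ _ CD0)[r r0 rP] := dh j0 t0 t0T.
pose s := Num.min T (t0 + r / 2).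
have sT : s <= T by rewrite ge_min lexx.
have sr : s <= t0 + r / 2 by rewrite ge_min lexx orbT.
have t0s : t0 < s by rewrite lt_min t0lt /= ltrDl divr_gt0.
have := rP s; rewrite gt_eqF// => /(_ isT).
have -> : `|s - t0| < r by rewrite gtr0_norm ?subr_gt0//; lra.
move=> /(_ isT); rewrite ler_norml => /andP[+ _].
have : 0 <= (h j0 s - h j0 t0) / (s - t0).
  rewrite divr_ge0 ?subr_ge0 ?(ltW t0s)// hmin// in_itv /= sT andbT.
  exact: le_trans t00 (ltW t0s).
lra.
Qed.

(** * The field in logarithmic coordinates *)

Definition lse (R : realType) (I : finType) (x : I -> R) : R :=
  ln (\sum_i expR (x i)).

Lemma sum_expR_gt0 (R : realType) (I : finType) (x : I -> R) (i : I) :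
  0 < \sum_j expR (x j).
Proof.
rewrite (bigD1 i)//= ltr_pwDl ?expR_gt0// sumr_ge0// => j _; exact: expR_ge0.
Qed.

Lemma expR_lse (R : realType) (I : finType) (x : I -> R) (i : I) :
  expR (lse x) = \sum_j expR (x j).
Proof. by rewrite lnK// posrE (sum_expR_gt0 x i). Qed.

Lemma le_lse (R : realType) (I : finType) (x : I -> R) (i : I) : x i <= lse x.
Proof.
by rewrite -ler_expR (expR_lse x i) (bigD1 i)//= lerDl sumr_ge0.
Qed.

(** Adding [d] to all coordinates adds [d] to [lse], which is monotone;
    therefore [lse] is 1-Lipschitz for the sup distance. *)
Lemma lse_leD (R : realType) (I : finType) (x y : I -> R) (d : R) (i : I) :
  (forall j, x j <= y j + d) -> lse x <= lse y + d.
Proof.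
move=> xy; rewrite -ler_expR expRD !(expR_lse _ i) mulr_suml; apply: ler_sum => j _.
by rewrite -expRD ler_expR.
Qed.

Lemma lse_lipschitz (R : realType) (I : finType) (x y : I -> R) (d : R) (i : I) :
  (forall j, `|x j - y j| <= d) -> `|lse x - lse y| <= d.
Proof.
move=> xy; rewrite ler_distlC; apply/andP; split.
  rewrite lerBlDr; apply: (lse_leD i) => j.
  by have := xy j; rewrite ler_norml => /andP[]; lra.
apply: (lse_leD i) => j; by have := xy j; rewrite ler_norml => /andP[]; lra.
Qed.

(** From the tangent inequality [1 + z <= exp z] at [z = v - u]. *)
Lemma expR_lipschitz (R : realType) (M u v : R) : u <= M -> v <= M ->
  `|expR u - expR v| <= expR M * `|u - v|.
Proof.
have half (x y : R) : x <= M -> expR x - expR y <= expR M * `|x - y|.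
  move=> xM; apply: (@le_trans _ _ (expR x * (x - y))).
    have : expR x * (1 + (y - x)) <= expR y.
      apply: le_trans (ler_wpM2l (expR_ge0 x) (expR_ge1Dx (y - x))) _.
      by rewrite -expRD addrC subrK.
    lra.
  apply: (@le_trans _ _ (expR x * `|x - y|)).
    by rewrite ler_wpM2l ?expR_ge0// ler_norm.
  by rewrite ler_wpM2r// ler_expR.
move=> uM vM; rewrite ler_norml; apply/andP; split; last exact: half.
by rewrite lerNl opprB distrC; exact: half.
Qed.

(** Each exponential is written with a single exponent, in terms of [x] and
    [lse x]; the sum is
    [exp (- e lse x)] times the average of [exp (- b x k)] with the softmax
    weights [exp (x k - lse x)]. *)
Definition rate (R : realType) (I : finType) (a b e : R) (c x : I -> R) (i : I)
    : R :=
  c i - \sum_k expR (x k - b * x k - (1 + e) * lse x)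
      + a^-1 * expR (- (b * x i) - e * lse x).

(** At the least coordinate, [exp (- b x i)] dominates the softmax average of
    the [exp (- b x k)], and the factor [a^-1 >= 1] only helps. *)
Lemma rate_argmin (R : realType) (I : finType) (a b e : R) (c x : I -> R) (i : I) :
  0 < a <= 1 -> 0 <= b -> (forall k, x i <= x k) -> c i <= rate a b e c x i.
Proof.
move=> /andP[a0 a1] b0 xi; rewrite /rate.
set E := expR (- (b * x i) - e * lse x).
have E0 : 0 <= E by exact: expR_ge0.
have : \sum_k expR (x k - b * x k - (1 + e) * lse x) <= E.
  apply: (@le_trans _ _ (\sum_k expR (x k - lse x) * E)).
    apply: ler_sum => k _; rewrite -expRD ler_expR.
    by have := ler_wpM2l b0 (xi k); lra.
  under eq_bigr => k _ do rewrite expRD.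
  by rewrite -!mulr_suml -(expR_lse x i) -expRD subrr expR0 mul1r.
have : E <= a^-1 * E by rewrite ler_peMl// -[leLHS]invr1 lef_pV2 ?posrE.
lra.
Qed.

(** Since [L <= x k <= lse x], both exponents are at most [- (b + e) L]: in
    [x k - b x k - (1 + e) lse x] the part [x k - lse x] is nonpositive.  So
    the exponentials are Lipschitz on an unbounded region. *)
Lemma rate_lipschitz (R : realType) (I : finType) (a b e L : R) (c : I -> R) :
  0 < a -> 0 <= b -> 0 <= e ->
  exists2 K, 0 < K & forall x y d, (forall j, L <= x j) -> (forall j, L <= y j) ->
    (forall j, `|x j - y j| <= d) ->
    forall i, `|rate a b e c x i - rate a b e c y i| <= K * d.
Proof.
move=> a0 b0 e0; pose E := expR (- (b + e) * L).
have E0 : 0 < E by exact: expR_gt0.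
pose Q := 2 + b + e.
exists ((\sum_(k : I) E * Q) + a^-1 * (E * Q)).
  rewrite ltr_wpDl//; first by apply: sumr_ge0 => k _; rewrite mulr_ge0// ?ltW// /Q; lra.
  by rewrite !mulr_gt0 ?invr_gt0// /Q; lra.
move=> x y d xL yL xyd i.
have sd := lse_lipschitz i xyd.
have d0 : 0 <= d := le_trans (normr_ge0 _) sd.
have term1 k : `|expR (x k - b * x k - (1 + e) * lse x)
    - expR (y k - b * y k - (1 + e) * lse y)| <= E * Q * d.
  have M (z : I -> R) : (forall j, L <= z j) ->
      z k - b * z k - (1 + e) * lse z <= - (b + e) * L.
    move=> zL; have h1 := le_lse z k.
    have h2 := ler_wpM2l b0 (zL k); have h3 := ler_wpM2l e0 (le_trans (zL k) h1).
    lra.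
  apply: le_trans (expR_lipschitz (M _ xL) (M _ yL)) _.
  rewrite -mulrA ler_pM2l//.
  have -> : x k - b * x k - (1 + e) * lse x - (y k - b * y k - (1 + e) * lse y) =
    (x k - y k) - b * (x k - y k) - (1 + e) * (lse x - lse y) by ring.
  apply: le_trans (ler_normB _ _) _.
  have h := ler_normB (x k - y k) (b * (x k - y k)).
  rewrite !normrM (ger0_norm b0) (ger0_norm (_ : 0 <= 1 + e)) in h *; last by lra.
  have h1 := ler_wpM2l b0 (xyd k); have h2 := ler_wpM2l e0 sd; have h3 := xyd k.
  rewrite /Q; lra.
have term2 : `|expR (- (b * x i) - e * lse x) - expR (- (b * y i) - e * lse y)|
    <= E * Q * d.
  have M (z : I -> R) : (forall j, L <= z j) ->
      - (b * z i) - e * lse z <= - (b + e) * L.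
    move=> zL; have h1 := le_lse z i.
    have h2 := ler_wpM2l b0 (zL i); have h3 := ler_wpM2l e0 (le_trans (zL i) h1).
    lra.
  apply: le_trans (expR_lipschitz (M _ xL) (M _ yL)) _.
  rewrite -mulrA ler_pM2l//.
  have -> : - (b * x i) - e * lse x - (- (b * y i) - e * lse y) =
    - (b * (x i - y i)) - e * (lse x - lse y) by ring.
  apply: le_trans (ler_normB _ _) _.
  rewrite normrN !normrM (ger0_norm b0) (ger0_norm e0).
  have h1 := ler_wpM2l b0 (xyd i); have h2 := ler_wpM2l e0 sd.
  rewrite /Q; lra.
have -> : rate a b e c x i - rate a b e c y i =
    a^-1 * (expR (- (b * x i) - e * lse x) - expR (- (b * y i) - e * lse y)) -
    \sum_k (expR (x k - b * x k - (1 + e) * lse x)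
              - expR (y k - b * y k - (1 + e) * lse y)).
  by rewrite sumrB /rate; ring.
apply: le_trans (ler_normB _ _) _; rewrite addrC [leRHS]mulrDl; apply: lerD.
  apply: le_trans (ler_norm_sum _ _ _) _.
  by rewrite mulr_suml; apply: ler_sum => k _.
by rewrite normrM gtr0_norm ?invr_gt0// -mulrA ler_pM2l ?invr_gt0.
Qed.

(** Everything in the equation besides the derivative is [theta i] times
    [1 - gamma] times [rate]: the exponents
    [(1 - gamma - alpha) / ((1 - alpha) (1 - gamma))], [1 / (alpha - 1)] and
    [alpha / (alpha - 1)] are [1 - b], [- (1 + e)] and [- e]. *)
Lemma ode_terms_rate (R : realType) (I : finType) (alpha gamma B b e : R)
    (rho theta : I -> R) (i : I) :
  0 < alpha < 1 -> gamma < 1 ->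
  b = alpha * gamma / ((1 - alpha) * (1 - gamma)) -> e = alpha / (1 - alpha) ->
  (forall j, 0 < theta j) ->
  (1 - gamma) * theta i *
    (B - (\sum_j theta j) `^ (1 / (alpha - 1)) *
         \sum_k theta k `^ ((1 - gamma - alpha) / ((1 - alpha) * (1 - gamma))))
  - (1 - gamma) * rho i * alpha^-1 * theta i
  + alpha^-1 * (1 - gamma) *
      theta i `^ ((1 - gamma - alpha) / ((1 - alpha) * (1 - gamma))) *
      (\sum_j theta j) `^ (alpha / (alpha - 1))
  = theta i * ((1 - gamma) *
      rate alpha b e (fun j => B - rho j / alpha) (fun j => ln (theta j)) i).
Proof.
move=> /andP[a0 a1] g1 bE eE th0.
have na0 : alpha != 0 by rewrite gt_eqF.
have na1 : 1 - alpha != 0 by rewrite gt_eqF// subr_gt0.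
have na1' : alpha - 1 != 0 by rewrite lt_eqF// subr_lt0.
have ng1 : 1 - gamma != 0 by rewrite gt_eqF// subr_gt0.
have -> : (1 - gamma - alpha) / ((1 - alpha) * (1 - gamma)) = 1 - b.
  by rewrite bE; field; rewrite ?na1 ?ng1 ?na1'.
have -> : 1 / (alpha - 1) = - (1 + e) by rewrite eE; field; rewrite ?na1 ?ng1 ?na1'.
have -> : alpha / (alpha - 1) = - e by rewrite eE; field; rewrite ?na1 ?ng1 ?na1'.
pose x j := ln (theta j).
have thE j : theta j = expR (x j) by rewrite lnK ?posrE.
have SE : \sum_j theta j = expR (lse x).
  by rewrite (expR_lse x i); apply: eq_bigr => j _.
have powE j y : theta j `^ y = expR (y * x j) by rewrite thE -expRM mulrC.
rewrite SE -!expRM /rate -/x.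
under eq_bigr => k _ do rewrite powE.
rewrite powE mulr_sumr.
under [in LHS]eq_bigr => k _ do rewrite -expRD.
under [in RHS]eq_bigr => k _.
  rewrite -/(x k) (_ : _ - _ = lse x * - (1 + e) + (1 - b) * x k); last by ring.
  over.
rewrite -/(x i) -[X in _ + X = _]mulrA -expRD.
rewrite (_ : expR (_ + _) = theta i * expR (- (b * x i) - e * lse x)); last first.
  by rewrite thE -expRD; congr expR; ring.
by rewrite /=; ring.
Qed.

(** * Well-posedness *)

(** The field is cut off below at [L = - C T].  Truncation preserves the
    order of coordinates, so [rate_argmin] still bounds the derivative of the
    least one by [C], and the solution stays above [- C (T - t) >= L], where
    cut-off and original field agree. *)
Lemma log_system_solution (R : realType) (I : finType) (T a b e kappa : R)
    (c : I -> R) :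
  0 <= T -> 0 < a <= 1 -> 0 <= b -> 0 <= e -> 0 < kappa ->
  exists Y : I -> R -> R, forall i, Y i T = 0 /\
    forall t, t \in `[0, T] ->
      is_derive t 1 (Y i) (- (kappa * rate a b e c (Y ^~ t) i)).
Proof.
move=> T0 a01 b0 e0 k0; have /andP[a0 _] := a01.
(* The summand 1 makes the inequality in [Cc] strict, as [min_principle]
   demands. *)
pose C := 1 + \sum_i kappa * `|c i|.
have Cc i : - (kappa * c i) < C.
  have : kappa * `|c i| <= \sum_j kappa * `|c j|.
    by rewrite (bigD1 i)//= lerDl sumr_ge0// => j _; rewrite mulr_ge0// ltW.
  have := ler_wpM2l (ltW k0) (ler_norm (- c i)); rewrite normrN /C; lra.
pose L := - (C * T).
have C0 : 0 < C.
  by rewrite /C ltr_pwDl// sumr_ge0// => j _; rewrite mulr_ge0// ltW.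
have [K K0 lipK] := rate_lipschitz L c a0 b0 e0.
pose cut (x : I -> R) j := Num.max L (x j).
pose G x i := - (kappa * rate a b e c (cut x) i).
have cutL x j : L <= cut x j by rewrite le_max lexx.
have lipG x y d : (forall j, `|x j - y j| <= d) ->
    forall i, `|G x i - G y i| <= kappa * K * d.
  move=> xyd i; rewrite /G -opprD normrN -mulrBr normrM gtr0_norm// -mulrA.
  rewrite ler_pM2l//; apply: lipK => // j; apply: le_trans (xyd j).
  rewrite /cut ler_norml; have := ler_norm (x j - y j).
  have := ler_norm (y j - x j); rewrite distrC.
  by case: (leP L (x j)) => ?; case: (leP L (y j)) => ? ? ?; apply/andP; split; lra.
have [Y YP] := cauchy_lipschitz (fun=> 0) T0 (mulr_gt0 k0 K0) lipG.
exists Y => i; have [YT dY] := YP i; split=> // t tT.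
suff YL j : cut (Y ^~ t) j = Y j t.
  by rewrite -[Y ^~ t](_ : cut (Y ^~ t) = _); [exact: dY|exact/funext].
apply/max_idPr.
have : 0 - C * (T - t) <= Y j t.
  apply: (min_principle (D := fun i t => G (Y ^~ t) i)) tT => [k|k s sT|k s sT kmin].
  - by have [->] := YP k.
  - by have [_] := YP k; apply.
  - apply: le_lt_trans (Cc k); rewrite lerN2 ler_pM2l//.
    by apply: rate_argmin => // l; rewrite /cut ge_max !le_max lexx kmin orbT.
have : 0 <= C * t.
  by rewrite mulr_ge0 ?(ltW C0)//; move: tT; rewrite in_itv /= => /andP[].
rewrite /L; lra.
Qed.

Lemma log_system_unique (R : realType) (I : finType) (T a b e kappa : R)
    (c : I -> R) (X Y : I -> R -> R) :
  0 < a -> 0 <= b -> 0 <= e -> 0 < kappa ->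
  (forall i, primitive_on 0 T (X i)
     (fun t => - (kappa * rate a b e c (X ^~ t) i))) ->
  (forall i, primitive_on 0 T (Y i)
     (fun t => - (kappa * rate a b e c (Y ^~ t) i))) ->
  (forall i, X i T = Y i T) ->
  forall i t, t \in `[0, T] -> X i t = Y i t.
Proof.
move=> a0 b0 e0 k0 dX dY XYT.
have [L1 L1P] := within_continuous_lower_bound (fun i => proj1 (dX i)).
have [L2 L2P] := within_continuous_lower_bound (fun i => proj1 (dY i)).
pose L := Num.min L1 L2.
have [K K0 lipK] := rate_lipschitz L c a0 b0 e0.
apply: (@lipschitz_unique _ _ T (kappa * K) (fun x => forall j, L <= x j)
  (fun x i => - (kappa * rate a b e c x i))) => //.
- by rewrite mulr_gt0.
- move=> x y d xL yL xyd i; rewrite -opprD normrN -mulrBr normrM gtr0_norm//.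
  by rewrite -mulrA ler_pM2l// lipK.
- by move=> t tT; split=> j; rewrite ge_min ?L1P// L2P// orbT.
Qed.

Theorem theorem4p5 (R : realType) (N : nat) (hN : (1 <= N)%N)
    (T alpha sigma nu mu gamma : R) (rho : 'I_N -> R)
    (hT : 0 < T) (halpha : 0 < alpha < 1) (hsigma : 0 < sigma)
    (hmu : nu < mu)
    (hgamma :
      (0 < gamma < 1 /\
       \big[Num.max/rho (Ordinal hN)]_(i < N) rho i <=
         alpha * (nu + (mu - nu) ^+ 2 / (2 * gamma * sigma ^+ 2))) \/
      1 - alpha <= gamma < 1) :
  exists theta : 'I_N -> R -> R,
    positive_solution T alpha sigma nu mu gamma rho theta /\
    (forall theta' : 'I_N -> R -> R,
       positive_solution T alpha sigma nu mu gamma rho theta' ->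
       forall (i : 'I_N) (t : R), t \in `[0, T] -> theta' i t = theta i t).
Proof.
have /andP[a0 a1] := halpha.
have [g0 g1] : 0 < gamma /\ gamma < 1.
  by case: hgamma => [[/andP[]]|/andP[? ?]] //; split=> //; lra.
pose B := nu + (mu - nu) ^+ 2 / (2 * gamma * sigma ^+ 2).
pose b := alpha * gamma / ((1 - alpha) * (1 - gamma)).
pose e := alpha / (1 - alpha).
pose c j := B - rho j / alpha.
have k0 : 0 < 1 - gamma by rewrite subr_gt0.
have b0 : 0 <= b by rewrite divr_ge0 ?mulr_ge0 ?subr_ge0// ltW.
have e0 : 0 <= e by rewrite divr_ge0 ?subr_ge0// ltW.
have a01 : 0 < alpha <= 1 by rewrite a0 ltW.
have odeE := @ode_terms_rate R 'I_N alpha gamma B b e rho _ _ halpha g1 erefl erefl.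
have [Y YP] := log_system_solution c (ltW hT) a01 b0 e0 k0.
exists (fun i t => expR (Y i t)); split.
  split; last by move=> i t _; exact: expR_gt0.
  split=> [i t tT|i]; last by have [-> _] := YP i; rewrite expR0.
  have [_ /(_ t tT) dY] := YP i.
  have dE := is_derive1_comp (is_derive_expR (Y i t)) dY.
  exists (expR (Y i t) * - ((1 - gamma) * rate alpha b e c (Y ^~ t) i)).
    exact: is_derive_is_derive_within.
  have := odeE (fun j => expR (Y j t)) i (fun j => expR_gt0 _).
  rewrite (_ : (fun j => ln (expR (Y j t))) = Y ^~ t); last first.
    by apply/funext => j; rewrite expRK.
  rewrite -/B -/c => E; rewrite -[X in X + _ = _]addrA -[LHS]addrA E.
  by rewrite mulrN addNr.
move=> theta' [[ode' end'] pos'] i t tT.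
suff <- : ln (theta' i t) = Y i t by rewrite lnK// posrE pos'.
apply: (log_system_unique a0 b0 e0 k0 (X := fun j s => ln (theta' j s))
          (c := c)) tT.
- move=> j.
  pose d s := theta' j s * - ((1 - gamma) *
                rate alpha b e c (fun k => ln (theta' k s)) j).
  have dP : primitive_on 0 T (theta' j) d.
    apply: is_derive_within_primitive_on => s sT.
    have [d' d'P E] := ode' j s sT.
    have := odeE (fun k => theta' k s) j (fun k => pos' k s sT).
    rewrite -/B -/c in E * => E'.
    rewrite -[X in X + _ = _]addrA -[LHS]addrA E' in E.
    rewrite (_ : d s = d')//; rewrite /d mulrN; lra.
  have [cL dL] := ln_primitive_on (pos' j) dP.
  split=> // s sT; apply: is_derive_eq (dL s sT) _.
  rewrite /d mulrA mulVf ?mul1r// gt_eqF// pos'//.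
  exact: subset_itv_oo_cc sT.
- by move=> j; have [_ dY] := YP j; exact: derive_primitive_on.
- by move=> j; rewrite end' ln1; have [->] := YP j.
Qed.
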